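(* Fix $s>1$. Given parameters $0<\delta\ll 1$ and $K\gg 1$, one can find an integer $N\gg 1$ and a set of frequencies $\Lambda\subset\mathbb{Z}^2$, written as a disjoint union $$\Lambda=\Lambda_1\cup\Lambda_2\cup\dots\cup\Lambda_N,$$ which satisfies Properties II, III, IV, V, VI listed in the context and also $$\frac{\sum_{n\in\Lambda_N}|n|^{2s}}{\sum_{n\in\Lambda_1}|n|^{2s}}\gtrsim\frac{K^2}{\delta^2}.$$ In addition, given any $\mathcal{R}\gg C(K,\delta)$ (that is, any $\mathcal R$ exceeding some constant depending on $K,\delta$), one can ensure that $\Lambda$ consists of $N\cdot 2^{N-1}$ distinct frequencies $n$ satisfying $|n|\ge\mathcal{R}$.
   Context: The exponent $s>1$ is fixed throughout and dependence of constants on $s$ is suppressed; the implied constant in $\gtrsim$ does not depend on $K$ or $\delta$. A rectangle $(n_1,n_2,n_3,n_4)$ in $\mathbb{Z}^2$ means a nondegenerate rectangle with corners $n_1,n_2,n_3,n_4$ in cyclic order, so $n_1,n_3$ are opposite corners and $n_2,n_4$ are opposite corners; equivalently $n_1-n_2+n_3=n_4$, $|n_1|^2-|n_2|^2+|n_3|^2-|n_4|^2=0$, $n_1\ne n_4$, $n_3\neq n_4$. The sets $\Lambda_j$ are called generations. A nuclear family is a rectangle $(n_1,n_2,n_3,n_4)$ such that for some $1\le j<N$ one has $n_1,n_3\in\Lambda_j$ (the parents) and $n_2,n_4\in\Lambda_{j+1}$ (the children). If $(n_1,n_2,n_3,n_4)$ is a nuclear family then so are its trivial permutations $(n_1,n_4,n_3,n_2)$,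 $(n_3,n_2,n_1,n_4)$, $(n_3,n_4,n_1,n_2)$. In a nuclear family, $n_1$ and $n_3$ are each other's spouse and $n_2,n_4$ are each other's sibling. Property II (Closure): whenever $(n_1,n_2,n_3,n_4)$ is a rectangle in $\mathbb{Z}^2$ such that three of the corners lie in $\Lambda$, the fourth corner lies in $\Lambda$. Property III (Existence and uniqueness of spouse and children): for any $1\le j<N$ and any $n_1\in\Lambda_j$ there exists a unique nuclear family $(n_1,n_2,n_3,n_4)$ (up to trivial permutations) such that $n_1$ is a parent of this family. In particular each $n_1\in\Lambda_j$ has a unique spouse $n_3\in\Lambda_j$ and two unique children $n_2,n_4\in\Lambda_{j+1}$ (up to permutation). Property IV (Existence and uniqueness of sibling and parents): for any $1\le j<N$ and any $n_2\in\Lambda_{j+1}$ there exists a unique nuclear family $(n_1,n_2,n_3,n_4)$ (up to trivial permutations) such that $n_2$ is a child of this family. In particular each $n_2\in\Lambda_{j+1}$ has a unique sibling $n_4\in\Lambda_{j+1}$ and two unique parents $n_1,n_3\in\Lambda_j$ (up to permutation). Property V (Nondegeneracy): the sibling of a frequency $n$ is never equal to its spouse. Property VI (Faithfulness): apart from the nuclear families, $\Lambda$ contains no other rectangles (indeed, by closure, it does not contain any right-angled triangles which are not coming from a nuclear family). *)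

(* Defs.v *)
From HB Require Import structures.
From mathcomp Require Import all_boot all_order all_algebra finmap.
From mathcomp Require Import all_classical all_reals all_analysis.

Set Implicit Arguments.
Unset Strict Implicit.
Unset Printing Implicit Defensive.

Import Order.TTheory GRing.Theory Num.Theory.

Local Open Scope ring_scope.

Definition Z2 : Type := (int * int)%type.

Definition normsq (n : Z2) : int := n.1 ^+ 2 + n.2 ^+ 2.

Definition euclid_norm (R : realType) (n : Z2) : R :=
  Num.sqrt ((normsq n)%:~R).

(* Corners are listed in cyclic order: n1, n3 are opposite, and so are n2, n4.
   The first equation says that they form a parallelogram; given it, the second
   says that n1 - n4 and n3 - n4 are orthogonal, and the last two exclude
   degenerate rectangles. *)
Definition rectangle (n1 n2 n3 n4 : Z2) : Prop :=
  [/\ n1 - n2 + n3 = n4,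
      normsq n1 - normsq n2 + normsq n3 - normsq n4 = 0,
      n1 <> n4 & n3 <> n4].

(* Generations are L 1, ..., L N; the other values of L are never used. *)
Section Generations.
Variables (N : nat) (L : nat -> {fset Z2}).

Definition nuclear_family (n1 n2 n3 n4 : Z2) : Prop :=
  rectangle n1 n2 n3 n4 /\
  exists j : nat, [/\ (1 <= j < N)%N, n1 \in L j, n3 \in L j,
                      n2 \in L j.+1 & n4 \in L j.+1].

Definition quad : Type := (Z2 * Z2 * Z2 * Z2)%type.

Definition is_nuclear_family (f : quad) : Prop :=
  let: (n1, n2, n3, n4) := f in nuclear_family n1 n2 n3 n4.

Definition is_parent (n : Z2) (f : quad) : Prop :=
  let: (n1, n2, n3, n4) := f in n = n1 \/ n = n3.

Definition is_child (n : Z2) (f : quad) : Prop :=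
  let: (n1, n2, n3, n4) := f in n = n2 \/ n = n4.

Definition trivial_permutation (f g : quad) : Prop :=
  let: (n1, n2, n3, n4) := f in
  [\/ g = (n1, n2, n3, n4), g = (n1, n4, n3, n2),
      g = (n3, n2, n1, n4) | g = (n3, n4, n1, n2)].

(* Trivial permutations of a nuclear family are nuclear families, so the order
   in which the two parents and the two children are listed is immaterial. *)
Definition spouse (n m : Z2) : Prop :=
  exists a b : Z2, nuclear_family n a m b.

Definition sibling (n m : Z2) : Prop :=
  exists a b : Z2, nuclear_family a n b m.

Definition unique_family (P : quad -> Prop) : Prop :=
  exists f : quad, [/\ is_nuclear_family f, P f &
    forall g : quad, is_nuclear_family g -> P g -> trivial_permutation f g].

Definition disjoint_generations : Prop :=
  forall (j k : nat) (n : Z2), (1 <= j <= N)%N -> (1 <= k <= N)%N ->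
    n \in L j -> n \in L k -> j = k.

Definition closure_property (Lam : {fset Z2}) : Prop :=
  forall n1 n2 n3 n4 : Z2, rectangle n1 n2 n3 n4 ->
    (3 <= count (fun n => n \in Lam) [:: n1; n2; n3; n4])%N ->
    all (fun n => n \in Lam) [:: n1; n2; n3; n4].

Definition spouse_and_children_property : Prop :=
  forall (j : nat) (n : Z2), (1 <= j < N)%N -> n \in L j ->
    unique_family (is_parent n).

Definition sibling_and_parents_property : Prop :=
  forall (j : nat) (n : Z2), (1 <= j < N)%N -> n \in L j.+1 ->
    unique_family (is_child n).

Definition nondegeneracy_property : Prop :=
  forall n m p : Z2, sibling n m -> spouse n p -> m <> p.

(* The cyclic order of a rectangle can be read from any corner, so the parents
   may be n1, n3 or n2, n4. *)
Definition faithfulness_property (Lam : {fset Z2}) : Prop :=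
  forall n1 n2 n3 n4 : Z2, rectangle n1 n2 n3 n4 ->
    n1 \in Lam -> n2 \in Lam -> n3 \in Lam -> n4 \in Lam ->
    nuclear_family n1 n2 n3 n4 \/ nuclear_family n2 n3 n4 n1.

End Generations.

Definition sobolev_sum (R : realType) (s : R) (A : {fset Z2}) : R :=
  \sum_(n <- A) euclid_norm R n `^ (2 * s).

(* Main.v *)
Require Import Defs.
From HB Require Import structures.
From mathcomp Require Import all_boot all_order all_algebra finmap.
From mathcomp Require Import all_classical all_reals all_analysis.
From mathcomp Require Import ring lra zify.

Set Implicit Arguments.
Unset Strict Implicit.
Unset Printing Implicit Defensive.

Import Order.TTheory GRing.Theory Num.Theory.

Local Open Scope ring_scope.

(** Put n = N - 1. The N 2^n frequencies are the images of abstract vertices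
    (j, b), where j <= n is the generation and b is one of the 2^n boolean
    functions on 'I_n. The families joining generation k to generation k + 1
    are indexed by the pairs {b, flip k b}, where flip k changes the value at k
    only: the parents are (k, b) and (k, flip k b), and the children are
    (k + 1, b) and (k + 1, flip k b). In this model the existence and
    uniqueness of families hold by construction, and nondegeneracy holds
    because the spouse of a vertex of generation j is obtained by flip j while
    its sibling is obtained by flip (j - 1).

    It remains to place the vertices in the plane so that every family is a
    rectangle and no other right-angled triangle appears ([general_position]).
    The placement is first made in the rational plane, one generation after the
    other. The children of a family may be put at the ends of any diameter of
    the circle whose diameter joins the parents, which leaves one parameter t,
    the points of the circle having a rational parametrisation. Each coincidence
    or right angle to be avoided is a quadratic equation in t
    ([generic_diameter]). It can hold for all t only if some point x already
    placed lies on the same circle. But then x is one of the parents and the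
    right angle belongs to the family, or else x and the two parents form a
    right-angled triangle; by general position x is then a child of theirs,
    which is absurd since these children are not placed yet. So all but finitely
    many values of t are admissible ([insert_children]).

    The same freedom serves to control the size. Place generation 0 on the unit
    circle, near powers of i, in such a way that at each later step two
    perpendicular parents q and p, approximately p = i q, can be given a child
    near p + q; this child is longer than its parents by the factor sqrt 2
    ([ideal], [placement]). After n steps one vertex lies near a point of norm
    2^(n/2). Multiplying by a common denominator and by a large integer moves
    everything to Z^2, arbitrarily far from the origin
    ([integral_placement]). The generation Lambda_(j + 1) of the statement
    consists of the images of the vertices (j, b). With X the common norm of the
    points of Lambda_1, the Sobolev sum of Lambda_1 is 2^n X^(2s), while that of
    Lambda_N is at least (2^n / 4)^s X^(2s). The quotient is at least
    4^(-s) 2^((s - 1) n), and this exceeds any bound because s > 1. *)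

(** * Right angles in the plane *)

Definition dot (R : pzRingType) (u v : R * R) : R := u.1 * v.1 + u.2 * v.2.

Lemma ext_pt (T : Type) (u v : T * T) : u.1 = v.1 -> u.2 = v.2 -> u = v.
Proof. by case: u v => ? ? [? ?] /= -> ->. Qed.

Lemma dot_eq0 (R : realDomainType) (u : R * R) : dot u u = 0 -> u = 0.
Proof.
case: u => a b; rewrite /dot /= => /eqP.
by rewrite -!expr2 paddr_eq0 ?sqr_ge0 // !expf_eq0 /= => /andP[/eqP-> /eqP->].
Qed.

Section Plane.
Variable F : realFieldType.
Implicit Types (u v w x y z m d c : F * F) (t eta : F).

Definition turn u : F * F := (- u.2, u.1).

(** Closeness of the coordinates, in a form that linear arithmetic can read. *)
Definition close_pt (eta : F) u v :=
  [/\ - eta <= u.1 - v.1, u.1 - v.1 <= eta, - eta <= u.2 - v.2 & u.2 - v.2 <= eta].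

Lemma dotC u v : dot u v = dot v u.
Proof. by rewrite /dot mulrC [u.2 * _]mulrC. Qed.

(** The triple (a, b, c) stands for the polynomial a + b t + c t^2. *)
Lemma quadratic_neq0_near0 (q : F * F * F) :
  exists2 delta : F, 0 < delta & forall t, 0 < t < delta ->
    q.1.1 + q.1.2 * t + q.2 * t ^+ 2 = 0 -> q = 0.
Proof.
case: q => [[a b] c] /=.
have [->|a0] := eqVneq a 0; last first.
  exists (Num.min 1 (`|a| / (`|b| + `|c| + 1))) => [|t].
    by rewrite lt_min ltr01 divr_gt0 ?normr_gt0 // ltr_wpDl ?addr_ge0.
  rewrite lt_min ltr_pdivlMr ?ltr_wpDl ?addr_ge0 // => /andP[t0 /andP[t1 tb]] e.
  suff : `|a| < `|a| by rewrite ltxx.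
  apply: le_lt_trans tb.
  have -> : a = - (b * t + c * t ^+ 2) by lra.
  rewrite normrN (le_trans (ler_normD _ _)) //.
  rewrite [ `|b * t|]normrM [ `|c * _|]normrM normrX (gtr0_norm t0).
  have := normr_ge0 b; have := normr_ge0 c.
  have tt : t ^+ 2 <= t by nra.
  by move: `|b| `|c| => B C hB hC; nra.
have [->|b0] := eqVneq b 0; last first.
  exists (`|b| / (`|c| + 1)) => [|t].
    by rewrite divr_gt0 ?normr_gt0 // ltr_wpDl.
  rewrite ltr_pdivlMr ?ltr_wpDl // => /andP[t0 tb] e.
  have e' : t * (b + c * t) = 0 by lra.
  move/eqP: e'; rewrite mulf_eq0 gt_eqF //= => /eqP e'.
  suff : `|b| < `|b| by rewrite ltxx.
  apply: le_lt_trans tb.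
  have -> : b = - (c * t) by lra.
  by rewrite normrN normrM (gtr0_norm t0); have := normr_ge0 c; nra.
exists 1 => // t /andP[t0 _]; rewrite mul0r !add0r => /eqP.
by rewrite mulf_eq0 expf_eq0 /= (gt_eqF t0) orbF => /eqP->.
Qed.

(** Excluding the roots by taking t small, rather than by counting them, makes
    genericity compatible with staying close to the position at t = 0. *)
Lemma quadratics_neq0_near0 (qs : seq (F * F * F)) :
  exists2 delta : F, 0 < delta & forall t, 0 < t < delta ->
    forall q, q \in qs -> q.1.1 + q.1.2 * t + q.2 * t ^+ 2 = 0 -> q = 0.
Proof.
elim: qs => [|q qs [d1 d10 h1]]; first by exists 1.
have [d2 d20 h2] := quadratic_neq0_near0 q.
exists (Num.min d1 d2) => [|t]; first by rewrite lt_min d10.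
rewrite lt_min => /and3P[t0 t1 t2] q'; rewrite inE => /orP[/eqP->|/h1]; last first.
  by apply; rewrite t0.
by apply: h2; rewrite t0.
Qed.

Lemma dot_turn_eq0 d w : d != 0 -> dot d w = 0 -> dot (turn d) w = 0 -> w = 0.
Proof.
case: d w => d1 d2 [w1 w2]; rewrite /dot /turn /= => d0 e1 e2.
have dd : d1 ^+ 2 + d2 ^+ 2 != 0.
  rewrite paddr_eq0 ?sqr_ge0 // !expf_eq0 /=; apply: contra d0 => /andP[/eqP-> /eqP->] //.
apply: ext_pt => /=; apply/eqP; rewrite -(mulrI_eq0 _ (mulfI dd)); apply/eqP.
  have -> : (d1 ^+ 2 + d2 ^+ 2) * w1 =
    d1 * (d1 * w1 + d2 * w2) - d2 * (- d2 * w1 + d1 * w2) by ring.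
  by rewrite e1 e2 !mulr0 subr0.
have -> : (d1 ^+ 2 + d2 ^+ 2) * w2 =
    d2 * (d1 * w1 + d2 * w2) + d1 * (- d2 * w1 + d1 * w2) by ring.
by rewrite e1 e2 !mulr0 addr0.
Qed.

(** With complex notation, m + d (1 + i t)^2 / (1 + t^2): the rational
    parametrisation of the circle of centre m through m + d, reached at
    t = 0. *)
Definition circ m d t : F * F :=
  (m.1 + ((1 - t ^+ 2) * d.1 - 2 * t * d.2) / (1 + t ^+ 2),
   m.2 + ((1 - t ^+ 2) * d.2 + 2 * t * d.1) / (1 + t ^+ 2)).

Lemma circ_den t : 1 + t ^+ 2 != 0.
Proof. by rewrite gt_eqF // ltr_wpDr ?sqr_ge0. Qed.

Lemma circ_dist m d t : dot (circ m d t - m) (circ m d t - m) = dot d d.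
Proof.
rewrite /dot /circ /=; field; exact: circ_den.
Qed.

Lemma circ_close m d eta : 0 < eta -> exists2 delta : F, 0 < delta &
  forall t, 0 < t < delta -> close_pt eta (circ m d t) (m + d).
Proof.
move=> eta0.
pose M := `|d.1| + `|d.2|.
have M0 : 0 <= M by rewrite addr_ge0.
exists (Num.min 1 (eta / (2 * (M + 1)))) => [|t].
  by rewrite lt_min ltr01 divr_gt0 // mulr_gt0 // ltr_wpDl.
rewrite lt_min ltr_pdivlMr ?mulr_gt0 ?ltr_wpDl // => /andP[t0 /andP[t1 tM]].
have key (a b : F) : `|a| + `|b| <= M ->
    `|(- 2 * t ^+ 2 * a + 2 * t * b) / (1 + t ^+ 2)| <= eta.
  move=> ab; have tt : 0 < 1 + t ^+ 2 by rewrite ltr_wpDr ?sqr_ge0.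
  rewrite normrM normfV (gtr0_norm tt) ler_pdivrMr //.
  apply: le_trans (ler_normD _ _) _.
  rewrite [ `|_ * a|]normrM [ `|_ * b|]normrM [ `|_ * t ^+ 2|]normrM normrX [ `|2 * t|]normrM.
  rewrite normrN (gtr0_norm t0) (ger0_norm (ler0n _ 2)).
  have := normr_ge0 a; have := normr_ge0 b; move: ab.
  move: `|a| `|b| => A B AB hB hA.
  have t2 : t ^+ 2 <= t by nra.
  have h1 : t ^+ 2 * A <= t * A by nra.
  have h2 : t * (A + B) <= t * M by nra.
  have h3 : 0 <= eta * t ^+ 2 by nra.
  by nra.
have e1 : (circ m d t).1 - (m + d).1 =
    (- 2 * t ^+ 2 * d.1 + 2 * t * - d.2) / (1 + t ^+ 2).
  by rewrite /circ /=; field; exact: circ_den.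
have e2 : (circ m d t).2 - (m + d).2 =
    (- 2 * t ^+ 2 * d.2 + 2 * t * d.1) / (1 + t ^+ 2).
  by rewrite /circ /=; field; exact: circ_den.
rewrite /close_pt e1 e2.
have := key d.1 (- d.2); rewrite normrN => /(_ (lexx _)); rewrite ler_norml => /andP[-> ->].
have := key d.2 d.1; rewrite addrC => /(_ (lexx _)); rewrite ler_norml => /andP[-> ->].
by [].
Qed.

(** A right angle involving the point c = m + (alpha + i beta) d of the circle
    is an equation A + B alpha + C beta = 0, because alpha^2 + beta^2 = 1 absorbs
    the terms of degree 2. Substituting alpha = (1 - t^2) / (1 + t^2) and
    beta = 2 t / (1 + t^2) gives (A + B) + 2 C t + (A - B) t^2 = 0. Here the
    right angle is at c, between x and y. *)
Definition quad_at m d x y : F * F * F :=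
  let A := dot (x - m) (y - m) + dot d d in
  let B := - dot d (x - m + (y - m)) in
  let C := - dot (turn d) (x - m + (y - m)) in
  (A + B, 2 * C, A - B).

(** The same for a right angle at z, between c and y. *)
Definition quad_off m d y z : F * F * F :=
  let A := dot (m - z) (y - z) in
  let B := dot d (y - z) in
  let C := dot (turn d) (y - z) in
  (A + B, 2 * C, A - B).

Lemma quad_atE m d x y t : dot (x - circ m d t) (y - circ m d t) = 0 ->
  let q := quad_at m d x y in q.1.1 + q.1.2 * t + q.2 * t ^+ 2 = 0.
Proof.
move=> e.
have -> : 0 = (1 + t ^+ 2) * dot (x - circ m d t) (y - circ m d t).
  by rewrite e mulr0.
by rewrite /quad_at /circ /dot /turn /=; field; exact: circ_den.
Qed.

Lemma quad_offE m d y z t : dot (circ m d t - z) (y - z) = 0 ->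
  let q := quad_off m d y z in q.1.1 + q.1.2 * t + q.2 * t ^+ 2 = 0.
Proof.
move=> e.
have -> : 0 = (1 + t ^+ 2) * dot (circ m d t - z) (y - z).
  by rewrite e mulr0.
by rewrite /quad_off /circ /dot /turn /=; field; exact: circ_den.
Qed.

Lemma quad_eq0 (a b c : F) : (a + b, 2 * c, a - b) = 0 -> [/\ a = 0, b = 0 & c = 0].
Proof. by case=> *; split; lra. Qed.

(** The quadratic polynomials above vanish identically only for trivial reasons:
    for a right angle at z, when y = z; for a right angle at c, when B = C = 0
    puts x and y symmetrically about m and A = 0 puts them on the circle, in
    which case Thales' theorem makes the right angle unavoidable. *)
Lemma generic_circle_point m d (W : seq (F * F)) eta :
  d != 0 -> 0 < eta ->
  exists c, [/\ dot (c - m) (c - m) = dot d d, close_pt eta c (m + d),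
    {in W &, forall x y, dot (x - c) (y - c) = 0 ->
       x + y = m + m /\ dot (x - m) (x - m) = dot d d} &
    {in W &, forall y z, dot (c - z) (y - z) = 0 -> y = z}].
Proof.
move=> d0 eta0.
have [d1 d10 h1] := circ_close m d eta0.
have [d2 d20 h2] := quadratics_neq0_near0
  ([seq quad_at m d x y | x <- W, y <- W] ++ [seq quad_off m d y z | y <- W, z <- W]).
pose t := Num.min d1 d2 / 2.
have t0 : 0 < Num.min d1 d2 by rewrite lt_min d10.
have [t1 t2] : 0 < t < d1 /\ 0 < t < d2.
  have lt : t < Num.min d1 d2 by rewrite /t; lra.
  have t0' : 0 < t by rewrite /t; lra.
  by split; rewrite t0' (lt_le_trans lt) // ge_min lexx ?orbT.
exists (circ m d t); split; [exact: circ_dist | exact: h1 | | ].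
  move=> x y xW yW /quad_atE /h2 => /(_ t2).
  have -> : quad_at m d x y \in [seq quad_at m d x y | x <- W, y <- W] ++
      [seq quad_off m d y z | y <- W, z <- W].
    by rewrite mem_cat allpairs_f.
  move=> /(_ isT) /quad_eq0 [eA eB eC].
  have exy : x - m + (y - m) = 0.
    by apply: (@dot_turn_eq0 d) => //; apply/eqP; rewrite -oppr_eq0; apply/eqP.
  have [e1 e2] : x.1 - m.1 + (y.1 - m.1) = 0 /\ x.2 - m.2 + (y.2 - m.2) = 0.
    by move: (congr1 fst exy) (congr1 snd exy).
  split; first by apply: ext_pt => /=; lra.
  move: eA; rewrite /dot /=.
  have -> : y.1 - m.1 = - (x.1 - m.1) by lra.
  have -> : y.2 - m.2 = - (x.2 - m.2) by lra.
  lra.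
move=> y z yW zW /quad_offE /h2 => /(_ t2).
have -> : quad_off m d y z \in [seq quad_at m d x y | x <- W, y <- W] ++
    [seq quad_off m d y z | y <- W, z <- W].
  by rewrite mem_cat orbC allpairs_f.
move=> /(_ isT) /quad_eq0 [_ eB eC].
by apply/eqP; rewrite -subr_eq0; apply/eqP; apply: (@dot_turn_eq0 d).
Qed.

Definition antipode m c : F * F := m + m - c.

Lemma antipodeK m : involutive (antipode m).
Proof. by move=> c; rewrite /antipode opprB addrCA subrr addr0. Qed.

Lemma antipode_sub m c w : antipode m c - w = - (c - antipode m w).
Proof. by apply: ext_pt; rewrite /antipode /=; ring. Qed.

Lemma dotN u v : dot (- u) (- v) = dot u v.
Proof. by rewrite /dot /=; ring. Qed.

Lemma dot_antipode m c z :
  dot (antipode m c - z) (c - z) = dot (z - m) (z - m) - dot (c - m) (c - m).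
Proof. by rewrite /dot /antipode /=; ring. Qed.

Definition avoids m d (W : seq (F * F)) c : Prop :=
  [/\ {in W, forall w, w <> c},
      {in W &, forall x y, dot (x - c) (y - c) = 0 ->
         x + y = m + m /\ dot (x - m) (x - m) = dot d d},
      {in W &, forall y z, dot (c - z) (y - z) = 0 -> y = z} &
      {in W, forall y, dot (antipode m c - c) (y - c) <> 0}].

(** The centre is added to the points to be avoided, since a right angle at c
    between its antipode and y is a right angle at c between m and y. *)
Lemma avoidsI m d W c : d != 0 ->
  {in m :: W &, forall x y, dot (x - c) (y - c) = 0 ->
     x + y = m + m /\ dot (x - m) (x - m) = dot d d} ->
  {in W &, forall y z, dot (c - z) (y - z) = 0 -> y = z} ->
  avoids m d W c.
Proof.
move=> d0 hat hoff.
have dd : 0 <> dot d d by move=> /esym/dot_eq0/eqP; rewrite (negbTE d0).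
have dot0 w : dot 0 w = 0 by rewrite /dot /= !mul0r addr0.
have mW : m \in m :: W by rewrite inE eqxx.
have WW w : w \in W -> w \in m :: W by move=> wW; rewrite inE wW orbT.
split=> //.
- move=> w /WW wW wc.
  have [|e ewd] := hat _ _ wW wW; first by rewrite wc subrr dot0.
  have [e1 e2] : w.1 + w.1 = m.1 + m.1 /\ w.2 + w.2 = m.2 + m.2.
    by split; [exact: (congr1 fst e) | exact: (congr1 snd e)].
  have wm : w = m by apply: ext_pt; lra.
  by apply: dd; rewrite -ewd wm subrr dot0.
- by move=> x y /WW xW /WW yW; exact: hat.
- move=> y /WW yW e.
  have [|_ h] := hat _ _ mW yW; last by apply: dd; rewrite -h subrr dot0.
  have : dot (antipode m c - c) (y - c) = 2 * dot (m - c) (y - c).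
    by rewrite /dot /antipode /=; ring.
  by rewrite e; lra.
Qed.

(** Both ends of a generic diameter are generic: the reflection in the centre
    carries the conditions on the antipode of c to conditions on c, once the set
    of points to be avoided is made symmetric. *)
Lemma generic_diameter m d W eta : d != 0 -> 0 < eta ->
  exists c, [/\ dot (c - m) (c - m) = dot d d, close_pt eta c (m + d),
    avoids m d W c & avoids m d W (antipode m c)].
Proof.
move=> d0 eta0.
pose W1 := m :: W; pose W2 := W1 ++ [seq antipode m w | w <- W1].
have W12 w : w \in W1 -> w \in W2 by move=> h; rewrite mem_cat h.
have aW12 w : w \in W1 -> antipode m w \in W2.
  by move=> h; rewrite mem_cat (map_f (antipode m)) ?orbT.
have W01 w : w \in W -> w \in W1 by move=> h; rewrite inE h orbT.
have [c [cd ccl hat hoff]] := generic_circle_point m W2 d0 eta0.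
exists c; split=> //; apply: avoidsI => //.
- by move=> x y /W12 xW /W12 yW; exact: hat.
- by move=> y z /W01/W12 yW /W01/W12 zW; exact: hoff.
- have reflect w : w - antipode m c = - (antipode m w - c).
    by rewrite antipode_sub opprK.
  move=> x y xW yW; rewrite !reflect dotN => /(hat _ _ (aW12 _ xW) (aW12 _ yW)).
  case=> e <-.
  have [e1 e2] : x.1 + y.1 = m.1 + m.1 /\ x.2 + y.2 = m.2 + m.2.
    move: (congr1 fst e) (congr1 snd e); rewrite /antipode /= => e1 e2.
    by split; lra.
  split; first exact: ext_pt.
  by rewrite antipode_sub dotN /antipode /dot /=; ring.
- move=> y z /W01 yW /W01 zW; rewrite antipode_sub.
  have -> : y - z = - (antipode m y - antipode m z).
    by apply: ext_pt; rewrite /antipode /=; ring.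
  rewrite dotN => /(hoff _ _ (aW12 _ yW) (aW12 _ zW)).
  exact: (can_inj (antipodeK m)).
Qed.

End Plane.

(** * The abstract families *)

Definition cell (n : nat) := {ffun 'I_n -> bool}.
Definition vertex (n : nat) : Type := (nat * cell n)%type.

Section Model.
Variable n : nat.
Implicit Types (k : 'I_n) (b : cell n) (x y z v : vertex n).

Definition flip k b : cell n := [ffun i => b i (+) (i == k)].

Lemma flipE k b i : flip k b i = b i (+) (i == k).
Proof. by rewrite ffunE. Qed.

Lemma flipK k : involutive (flip k).
Proof. by move=> b; apply/ffunP => i; rewrite !flipE -addbA addbb addbF. Qed.

Lemma flip_inj2 k k' b : flip k b = flip k' b -> k = k'.
Proof.
move/ffunP/(_ k); rewrite !flipE eqxx => /(can_inj (addKb _)) /esym /eqP.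
by [].
Qed.

Lemma flip_neq k b : flip k b != b.
Proof. by apply/eqP => /ffunP/(_ k); rewrite flipE eqxx addbT; case: (b k). Qed.

Definition parent_of k b : vertex n := (nat_of_ord k, b).
Definition child_of k b : vertex n := (k.+1, b).

(** The corner z of a family together with the two corners x, y next to it:
    spouses and one of their children, or siblings and one of their parents. *)
Definition family_triple x z y : Prop := exists k b,
  [/\ x = parent_of k b, y = parent_of k (flip k b) &
      z = child_of k b \/ z = child_of k (flip k b)] \/
  [/\ x = child_of k b, y = child_of k (flip k b) &
      z = parent_of k b \/ z = parent_of k (flip k b)].

Lemma family_triple_sym x z y : family_triple x z y -> family_triple y z x.
Proof.
case=> k [b H]; exists k, (flip k b); rewrite flipK.
by case: H => -[-> -> H]; [left|right]; split=> //; case: H; [right|left|right|left].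
Qed.

(** Spouses are never siblings, so in a family triple they can only be the
    parents of the third vertex. *)
Lemma spouses_triple k b z : family_triple (parent_of k b) z (parent_of k (flip k b)) ->
  z = child_of k b \/ z = child_of k (flip k b).
Proof.
case=> k' [b' []] [].
  by case=> /val_inj <- <- _.
case=> kk' <- [_ /flip_inj2 e]; move: kk'; rewrite e => kk'.
by have := ltnn k'; rewrite {2}kk' ltnS leqnn.
Qed.

End Model.

(** * Placing vertices in general position *)

Section Placement.
Variables (F : realFieldType) (n : nat).
Notation V := (vertex n).
Implicit Types (f : V -> F * F) (S : seq V).

Definition general_position f S : Prop :=
  [/\ {in S, forall v, f v != 0}, {in S &, injective f} &
      {in S & &, forall x z y, x <> z -> y <> z -> x <> y ->
        dot (f x - f z) (f y - f z) = 0 -> family_triple x z y}].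

Definition extend f v (P : F * F) : V -> F * F := fun w => if w == v then P else f w.

Lemma extend_same f v P : extend f v P v = P.
Proof. by rewrite /extend eqxx. Qed.

Lemma extend_in f v P S : v \notin S -> {in S, extend f v P =1 f}.
Proof. by move=> vS w wS; rewrite /extend; case: eqP => // wv; rewrite -wv wS in vS. Qed.

Lemma general_position_extend f S v P : general_position f S -> v \notin S -> P != 0 ->
  {in S, forall w, f w <> P} ->
  {in S &, forall x y, x <> y -> dot (f x - P) (f y - P) = 0 -> family_triple x v y} ->
  {in S &, forall y z, y <> z -> dot (P - f z) (f y - f z) = 0 -> family_triple v z y} ->
  general_position (extend f v P) (v :: S).
Proof.
move=> [f0 finj fgen] vS P0 fP hat hoff.
have ein := extend_in f P vS.
split.
- move=> w; rewrite inE => /orP[/eqP->|wS]; first by rewrite extend_same.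
  by rewrite ein //; exact: f0.
- move=> w w'; rewrite !inE => /orP[/eqP->|wS] /orP[/eqP->|wS'] //;
    rewrite ?extend_same ?ein //.
  + by move/esym/(fP _ wS').
  + by move/(fP _ wS).
  + exact: finj.
- move=> x z y; rewrite !inE => /orP[/eqP->|xS] /orP[/eqP->|zS] /orP[/eqP->|yS] //;
    rewrite ?extend_same ?ein //.
  + by move=> _ yz _; exact: hoff.
  + by move=> _ _ xy; exact: hat.
  + by move=> xz _ _; rewrite dotC => /(hoff _ _ xS zS xz) /family_triple_sym.
  + exact: fgen.
Qed.

(** Two antipodal points are seen under a right angle from every other point of
    the circle, hence the second clause. *)
Definition on_circle f S :=
  {in S, forall v, dot (f v) (f v) = 1} /\ {in S &, forall v w, f v + f w <> 0}.

Lemma insert_first f S v d eta :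
  general_position f S -> on_circle f S -> v \notin S -> dot d d = 1 -> 0 < eta ->
  exists f', [/\ {in S, f' =1 f}, general_position f' (v :: S),
    on_circle f' (v :: S) & close_pt eta (f' v) d].
Proof.
move=> gf [circ_f anti_f] vS d1 eta0.
have d0 : d != 0.
  apply/eqP => e; move: d1; rewrite e /dot /= !mulr0 addr0 => /esym/eqP.
  by rewrite oner_eq0.
pose W := 0 :: [seq f w | w <- S].
have W0 : 0 \in W by rewrite inE eqxx.
have WS w : w \in S -> f w \in W by move=> wS; rewrite inE map_f ?orbT.
have [c [cd ccl [cW hat hoff _] [aW _ _ _]]] := generic_diameter 0 W d0 eta0.
rewrite subr0 d1 in cd; rewrite add0r in ccl.
have aE : antipode 0 c = - c by rewrite /antipode addr0 sub0r.
have ein := extend_in f c vS.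
have anti w : w \in S -> f w + c <> 0.
  by move=> wS /eqP; rewrite addr_eq0 => /eqP e; apply: (aW _ (WS _ wS)); rewrite aE.
exists (extend f v c); split=> //; last by rewrite extend_same.
- apply: general_position_extend => //.
  + by apply/eqP => /esym; exact: cW.
  + by move=> w wS; apply/cW/WS.
  + move=> x y xS yS _ /hat -/(_ (WS _ xS) (WS _ yS)) [].
    by rewrite addr0 => /(anti_f _ _ xS yS).
  + move=> y z yS zS yz /hoff -/(_ (WS _ yS) (WS _ zS)).
    by case: gf => _ finj _ /finj-/(_ yS zS).
- split.
    move=> w; rewrite inE => /orP[/eqP->|wS]; first by rewrite extend_same cd.
    by rewrite ein ?circ_f.
  move=> w w'; rewrite !inE => /orP[/eqP->|wS] /orP[/eqP->|wS'];
      rewrite ?extend_same ?ein //.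
  + move=> e; apply: (cW 0 W0).
    have [e1 e2] : c.1 + c.1 = 0 /\ c.2 + c.2 = 0.
      by split; [exact: (congr1 fst e) | exact: (congr1 snd e)].
    by apply: ext_pt => /=; lra.
  + by rewrite addrC; exact: anti.
  + exact: anti.
  + exact: anti_f.
Qed.

Lemma half_pt (u : F * F) : exists v : F * F, v + v = u.
Proof. by exists (u.1 / 2, u.2 / 2); apply: ext_pt => /=; lra. Qed.

(** The power of z with respect to the circle with diameter from p to q. *)
Lemma dot_diameter (p q m d z : F * F) : m + m = p + q -> d + d = q - p ->
  dot (p - z) (q - z) = dot (z - m) (z - m) - dot d d.
Proof.
move=> em ed.
have [m1 m2] : m.1 + m.1 = p.1 + q.1 /\ m.2 + m.2 = p.2 + q.2.
  by split; [exact: (congr1 fst em) | exact: (congr1 snd em)].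
have [d1 d2] : d.1 + d.1 = q.1 - p.1 /\ d.2 + d.2 = q.2 - p.2.
  by split; [exact: (congr1 fst ed) | exact: (congr1 snd ed)].
rewrite /dot /=.
have -> : q.1 = m.1 + d.1 by lra.
have -> : q.2 = m.2 + d.2 by lra.
have -> : p.1 = m.1 - d.1 by lra.
have -> : p.2 = m.2 - d.2 by lra.
ring.
Qed.

(** The circle whose diameter joins spouses contains no point already placed
    except the spouses: any other point of the circle sees them under a right
    angle, hence would be one of their children. Therefore a generic diameter of
    this circle creates only the right angles of the family. *)
Lemma insert_children f S k b eta :
  let p := parent_of k b in let q := parent_of k (flip k b) in
  let c := child_of k b in let c' := child_of k (flip k b) in
  general_position f S -> p \in S -> q \in S -> c \notin S -> c' \notin S ->
  0 < eta ->
  exists f', [/\ {in S, f' =1 f}, general_position f' [:: c', c & S],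
    f p + f q = f' c + f' c',
    dot (f p - f' c) (f q - f' c) = 0 &
    exists2 d, d + d = f q - f p &
    exists2 m, m + m = f p + f q & close_pt eta (f' c) (m + turn d)].
Proof.
move=> p q c c' gf pS qS cS c'S eta0.
have [f0 finj fgen] := gf.
have [m mE] := half_pt (f p + f q).
have [d dE] := half_pt (f q - f p).
have pq : p <> q by case=> /esym/eqP; rewrite (negbTE (flip_neq _ _)).
have dn : dot (turn d) (turn d) = dot d d by rewrite /dot /=; ring.
have td0 : turn d != 0.
  apply/eqP => e; have : d = 0 by apply: dot_eq0; rewrite -dn e /dot /= mulr0 addr0.
  move=> d0; move: dE; rewrite d0 addr0 => /esym/eqP; rewrite subr_eq0 => /eqP.
  by move/(finj _ _ qS pS)/esym.
have right z : dot (z - m) (z - m) = dot d d -> dot (f p - z) (f q - z) = 0.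
  by move=> e; rewrite (dot_diameter z mE dE) e subrr.
have circle z : z \in S -> dot (f z - m) (f z - m) = dot d d -> z = p \/ z = q.
  move=> zS /right e.
  have [|/eqP zp] := eqVneq z p; first by left.
  have [|/eqP zq] := eqVneq z q; first by right.
  have /spouses_triple : family_triple p z q.
    by apply: fgen => //; move/esym.
  by case=> e'; move: zS; rewrite e' ?(negbTE cS) ?(negbTE c'S).
have antip x y : x \in S -> y \in S -> f x + f y = m + m ->
    dot (f x - m) (f x - m) = dot d d -> (x = p /\ y = q) \/ (x = q /\ y = p).
  move=> xS yS exy /(circle _ xS) [] e; [left | right]; split=> //;
    apply: finj => //; apply: (addrI (f x)); rewrite exy mE e // addrC //.
have pcq z : z = c \/ z = c' -> family_triple p z q by exists k, b; left.
have cpc z : z = p \/ z = q -> family_triple c z c' by exists k, b; right.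
pose W := 0 :: [seq f w | w <- S].
have W0 : 0 \in W by rewrite inE eqxx.
have WS w : w \in S -> f w \in W by move=> wS; rewrite inE map_f ?orbT.
have [P [Pd Pcl [PW hat hoff hanti] [PW' hat' hoff' hanti']]] :=
  generic_diameter m W td0 eta0.
rewrite dn in Pd hat hat'; rewrite antipodeK in hanti'.
pose P' := antipode m P; rewrite -/P' in PW' hat' hoff' hanti hanti'.
have PP' : P <> P'.
  by move=> e; apply: (hanti _ W0); rewrite -e subrr /dot /= !mul0r addr0.
pose g := extend f c P.
have gS : {in S, g =1 f} by exact: extend_in.
have gc : g c = P by exact: extend_same.
have gg : general_position g (c :: S).
  apply: general_position_extend => //.
  - by apply/eqP => /esym; exact: PW.
  - by move=> w wS; apply/PW/WS.
  - move=> x y xS yS _ /hat -/(_ (WS _ xS) (WS _ yS)) [exy].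
    case/(antip _ _ xS yS exy) => -[-> ->]; first by apply: pcq; left.
    by apply/family_triple_sym/pcq; left.
  - move=> y z yS zS yz /hoff -/(_ (WS _ yS) (WS _ zS)) e.
    by case: yz; exact: finj.
have c'cS : c' \notin c :: S.
  rewrite inE negb_or c'S andbT; apply/eqP; case=> /eqP; exact/negP/flip_neq.
pose g' := extend g c' P'.
have g'S : {in S, g' =1 f}.
  by move=> w wS; rewrite /g' (extend_in _ _ c'cS) ?gS // inE wS orbT.
have g'c : g' c = P by rewrite /g' (extend_in _ _ c'cS) ?gc // inE eqxx.
have g'c' : g' c' = P' by exact: extend_same.
exists g'; split => //.
- apply: general_position_extend => //.
  + by apply/eqP => /esym; exact: PW'.
  + move=> w; rewrite inE => /orP[/eqP->|wS]; first by rewrite gc.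
    by rewrite gS //; apply/PW'/WS.
  + move=> x y; rewrite !inE => /orP[/eqP->|xS] /orP[/eqP->|yS] //;
      rewrite ?gc ?gS //.
    * by move=> _ /(hanti' _ (WS _ yS)).
    * by move=> _; rewrite dotC => /(hanti' _ (WS _ xS)).
    * move=> _ /hat' -/(_ (WS _ xS) (WS _ yS)) [exy].
      case/(antip _ _ xS yS exy) => -[-> ->]; first by apply: pcq; right.
      by apply/family_triple_sym/pcq; right.
  + move=> y z; rewrite !inE => /orP[/eqP->|yS] /orP[/eqP->|zS] //;
      rewrite ?gc ?gS //.
    * move=> _ /eqP; rewrite dot_antipode subr_eq0 Pd => /eqP /(circle _ zS).
      by move/cpc/family_triple_sym.
    * by move=> _ /(hanti _ (WS _ yS)).
    * by move=> yz /hoff' -/(_ (WS _ yS) (WS _ zS)) e; case: yz; exact: finj.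
- by rewrite g'c g'c' -mE /P' /antipode addrCA subrr addr0.
- by rewrite g'c; apply: right.
- by exists d => //; exists m => //; rewrite g'c.
Qed.

End Placement.

(** * The positions to be approximated *)

Section Ideal.
Variables (F : realFieldType) (n : nat).
Implicit Types (k : 'I_n) (b : cell n).

Definition weight j b : nat := (\sum_(i < n | (j <= i)%N) b i)%N.

Lemma weight_succ k b : weight k b = (b k + weight k.+1 b)%N.
Proof.
rewrite /weight (bigD1 k) //=; congr addn; apply: eq_bigl => i.
by rewrite ltn_neqAle eq_sym andbC.
Qed.

Lemma weight_flip k b : weight k.+1 (flip k b) = weight k.+1 b.
Proof.
apply: eq_bigr => i ki; rewrite flipE (_ : (i == k) = false) ?addbF //.
by apply/eqP => e; rewrite e ltnn in ki.
Qed.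

(** In complex notation, (1 + i)^j times i to the power weight j b. Only the
    vertices (j, b) with b true below j are meant to lie near this point. *)
Definition ideal j b : F * F :=
  iter j (fun z => z + turn z) (iter (weight j b) (@turn F) (1, 0)).

Lemma iter_turn j (z : F * F) :
  iter j (fun z => z + turn z) (turn z) = turn (iter j (fun z => z + turn z) z).
Proof.
by elim: j => //= j ->; apply: ext_pt; rewrite /turn /=; ring.
Qed.

Lemma ideal_parents k b : b k ->
  ideal k b = turn (ideal k (flip k b)).
Proof.
move=> bk; rewrite /ideal !weight_succ weight_flip flipE eqxx bk /= add0n.
exact: iter_turn.
Qed.

Lemma ideal_child k b : b k ->
  ideal k.+1 b = ideal k (flip k b) + turn (ideal k (flip k b)).
Proof. by move=> bk; rewrite /ideal (weight_succ k) weight_flip flipE eqxx bk. Qed.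

Lemma ideal_norm j b : dot (ideal j b) (ideal j b) = 2 ^+ j.
Proof.
rewrite /ideal; elim: j (weight j b) => [|j IH] w.
  rewrite expr0 /=; elim: w => [|w IH] /=; first by rewrite /dot /=; ring.
  by rewrite -[RHS]IH /dot /turn /=; ring.
by rewrite exprS -(IH w) /= /dot /turn /=; ring.
Qed.

End Ideal.

(** * Placing all generations *)

Definition family_placed (R : pzRingType) n (f : vertex n -> R * R)
    (k : 'I_n) (b : cell n) : Prop :=
  f (parent_of k b) + f (parent_of k (flip k b)) =
    f (child_of k b) + f (child_of k (flip k b)) /\
  dot (f (parent_of k b) - f (child_of k b))
      (f (parent_of k (flip k b)) - f (child_of k b)) = 0.

Section Generations.
Variables (F : realFieldType) (n : nat).
Notation V := (vertex n).
Implicit Types (f : V -> F * F) (S : seq V) (k : 'I_n) (b : cell n).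

Lemma place_first eta (bs : seq (cell n)) : 0 < eta -> uniq bs ->
  exists f, let S := [seq (0%N, b) | b <- bs] in
  [/\ general_position f S, on_circle f S &
      {in bs, forall b, close_pt eta (f (0%N, b)) (ideal F 0 b)}].
Proof.
move=> eta0; elim: bs => [_|b bs IH /= /andP[bbs /IH [f [gf cf clf]]]].
  by exists (fun _ => 0).
have bS : (0%N, b) \notin [seq (0%N, b) | b <- bs].
  by apply/mapP => -[b' b'S [e]]; rewrite e b'S in bbs.
have [|f' [ff' gf' cf' clf']] := insert_first (d := ideal F 0 b) gf cf bS _ eta0.
  by rewrite ideal_norm.
exists f'; split=> // b'; rewrite inE => /orP[/eqP->//|b'bs].
by rewrite ff' ?map_f //; exact: clf.
Qed.

Lemma family_placed_flip f k b : family_placed f k b -> family_placed f k (flip k b).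
Proof.
rewrite /family_placed flipK.
move: (f _) (f _) (f _) (f _) => c' c q p [e o].
split; first by rewrite addrC e [RHS]addrC.
have -> : c' = p + q - c by rewrite e addrC addKr.
by move: o; rewrite /dot /=; lra.
Qed.

(** With m and d the midpoint and half the difference of the parents, m + i d is
    the end of the perpendicular diameter; when the parent with b true is i
    times the other parent, it is the sum of the parents. *)
Definition true_child_close eta f k b : Prop :=
  exists2 d, d + d = f (parent_of k (flip k b)) - f (parent_of k b) &
  exists2 m, m + m = f (parent_of k b) + f (parent_of k (flip k b)) &
    close_pt eta (f (child_of k b)) (m + turn d).

(** A family {b, flip k b} is represented by its member that is true at k: that
    child is the one whose position is controlled. *)
Lemma place_next eta f S k (bs : seq (cell n)) : 0 < eta -> general_position f S ->
  (forall v, v \in S = (v.1 <= k)%N) -> uniq bs -> {in bs, forall b, b k} ->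
  exists f', let S' := flatten [seq [:: child_of k (flip k b); child_of k b] | b <- bs] ++ S in
  [/\ {in S, f' =1 f}, general_position f' S' &
      {in bs, forall b, family_placed f' k b /\ true_child_close eta f' k b}].
Proof.
move=> eta0 gf SE; elim: bs => [_ _|b bs IH /= /andP[bbs ubs] bsk]; first by exists f.
have [|f1 [f1f gf1 fam1]] := IH ubs.
  by move=> b' b'bs; apply: bsk; rewrite inE b'bs orbT.
set S1 := _ ++ S in gf1.
have S1E v : v \in S1 = (v.1 <= k)%N || (v.1 == k.+1) && ((v.2 \in bs) || (flip k v.2 \in bs)).
  rewrite mem_cat SE orbC; congr orb.
  apply/flattenP/idP => [[l /mapP[b' b'bs ->]]|].
    by rewrite !inE => /orP[] /eqP-> /=; rewrite eqxx ?flipK b'bs ?orbT.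
  case: v => j b' /= /andP[/eqP-> /orP[] h].
    by eexists; [exact: map_f h | rewrite !inE eqxx orbT].
  by eexists; [exact: map_f h | rewrite flipK !inE eqxx].
have bk : b k by apply: bsk; rewrite inE eqxx.
have fbbs : flip k b \notin bs.
  apply/negP => h; have := bsk (flip k b); rewrite inE h orbT flipE eqxx bk.
  by move/(_ isT).
have pS b' : parent_of k b' \in S1 by rewrite S1E /= leqnn.
have [||f2 [f21 gf2 e o cl]] := insert_children gf1 (pS b) (pS (flip k b)) _ _ eta0.
- by rewrite S1E /= ltnn eqxx (negbTE bbs) (negbTE fbbs).
- by rewrite S1E /= ltnn eqxx flipK (negbTE bbs) (negbTE fbbs).
exists f2; split=> //.
- by move=> v vS; rewrite f21 ?f1f // mem_cat vS orbT.
- move=> b'; rewrite inE => /orP[/eqP->|b'bs].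
    by rewrite /family_placed /true_child_close !(f21 (parent_of _ _)).
  have := fam1 _ b'bs; rewrite /family_placed /true_child_close.
  by rewrite !f21 // S1E /= eqxx ?b'bs ?flipK ?b'bs ?orbT.
Qed.

Definition placed eta j f : Prop :=
  [/\ exists2 S : seq V, (forall v, v \in S = (v.1 <= j)%N) & general_position f S,
      forall b, dot (f (0%N, b)) (f (0%N, b)) = 1,
      forall k b, (k < j)%N -> family_placed f k b &
      forall b, (forall i : 'I_n, (i < j)%N -> b i) -> close_pt eta (f (j, b)) (ideal F j b)].

(** The error of a child is at most twice the error of its parents, plus that of
    its own choice: asking for eta / 4 twice leaves room for eta. *)
Lemma placement j eta : (j <= n)%N -> 0 < eta -> exists f, placed eta j f.
Proof.
elim: j eta => [|j IH] eta jn eta0.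
  have [f [gf [cf _] clf]] := place_first eta0 (enum_uniq (cell n)).
  have SE v : v \in [seq (0%N, b) | b <- enum (cell n)] = (v.1 <= 0)%N.
    case: v => -[|j] b /=; first by rewrite map_f ?mem_enum.
    by apply/mapP => -[].
  exists f; split=> //.
  - by exists [seq (0%N, b) | b <- enum (cell n)].
  - by move=> b; apply: cf; rewrite SE.
  - by move=> b _; apply: clf; rewrite mem_enum.
have eta40 : 0 < eta / 4 by lra.
have [f [[S SE gf] c0 fam cl]] := IH _ (ltnW jn) eta40.
pose k : 'I_n := Ordinal jn.
have [||f' [ff' gf' fam']] := @place_next (eta / 4) f S k
  [seq b : cell n <- enum (cell n) | b k] eta40 gf SE.
- by rewrite filter_uniq ?enum_uniq.
- by move=> b; rewrite mem_filter => /andP[].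
have bsE b : b k -> b \in [seq b : cell n <- enum (cell n) | b k].
  by rewrite mem_filter mem_enum andbT.
have ff i b : (i <= j)%N -> f' (i, b) = f (i, b) by move=> ij; rewrite ff' // SE.
exists f'; split.
- eexists; last exact: gf'.
  move=> [i b]; rewrite mem_cat SE /= [RHS]leq_eqVlt ltnS ![_ || (i <= j)%N]orbC.
  apply: orb_id2l => ij.
  apply/flattenP/idP => [[l /mapP[b' _ ->]]|/eqP->].
    by rewrite !inE => /orP[] /eqP[-> _].
  have [bk|bk] := boolP (b k).
    by eexists; [apply: map_f; exact: bsE bk | rewrite !inE eqxx orbT].
  eexists; [apply: map_f; apply: (bsE (flip k b)); by rewrite flipE eqxx (negbTE bk) |].
  by rewrite flipK !inE eqxx.
- by move=> b; rewrite ff.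
- move=> i b; rewrite ltnS leq_eqVlt => /orP[/eqP ij|ij].
    have -> : i = k by exact: val_inj.
    have [/bsE/fam'[]//|bk] := boolP (b k).
    rewrite -(flipK k b); apply: family_placed_flip.
    by have [] := fam' (flip k b) _; rewrite // bsE // flipE eqxx (negbTE bk).
  have := fam i b ij; rewrite /family_placed !ff //; exact: ltnW.
- move=> b hb; have bk : b k by exact: hb.
  have [_ [d dE [m mE clc]]] := fam' b (bsE b bk).
  have hp : close_pt (eta / 4) (f (j, b)) (ideal F j b).
    by apply: cl => i ij; apply: hb; exact: ltnW.
  have hq : close_pt (eta / 4) (f (j, flip k b)) (ideal F j (flip k b)).
    apply: cl => i ij; have ik : (i == k) = false.
      by apply/eqP => e; rewrite e ltnn in ij.
    by rewrite flipE ik addbF; apply: hb; exact: ltnW.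
  move: clc dE mE hp hq; rewrite /child_of /parent_of /= !(ff j) //.
  rewrite (ideal_child F bk) (ideal_parents F bk).
  move: (f _) (f _) (f' _) (ideal _ _ _) => p q c I [c1 c2 c3 c4] dE mE.
  have [d1 d2] : d.1 + d.1 = q.1 - p.1 /\ d.2 + d.2 = q.2 - p.2.
    by split; [exact: (congr1 fst dE) | exact: (congr1 snd dE)].
  have [m1 m2] : m.1 + m.1 = p.1 + q.1 /\ m.2 + m.2 = p.2 + q.2.
    by split; [exact: (congr1 fst mE) | exact: (congr1 snd mE)].
  move: c1 c2 c3 c4; rewrite /turn /= => c1 c2 c3 c4 [p1 p2 p3 p4] [q1 q2 q3 q4].
  move: p1 p2 p3 p4 q1 q2 q3 q4; rewrite /turn /= => p1 p2 p3 p4 q1 q2 q3 q4.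
  by split=> /=; lra.
Qed.

End Generations.

(** * From a placement in Z^2 to the required sets *)

Lemma rectangle_of_dot (a b c d : Z2) : a + c = b + d ->
  dot (a - b) (c - b) = 0 -> a <> b -> c <> b -> rectangle a b c d.
Proof.
move=> e o ab cb; have dE : d = a + c - b by rewrite e addrC addKr.
split.
- by rewrite dE addrAC.
- by rewrite dE; move: o; rewrite /dot /normsq /=; lra.
- by move=> ad; apply: cb; apply: (addrI a); rewrite e addrC ad.
- by move=> cd; apply: ab; apply: (addIr c); rewrite e cd.
Qed.

Lemma rectangle_dot (a b c d : Z2) : rectangle a b c d ->
  [/\ a + c = b + d, dot (a - b) (c - b) = 0, a <> b, c <> b & a <> c].
Proof.
case=> <- o ad cd; split.
- by rewrite addrAC addrCA subrr addr0.
- by move: o; rewrite /dot /normsq /=; lra.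
- by move=> ab; apply: cd; rewrite ab subrr add0r.
- by move=> cb; apply: ad; rewrite cb subrK.
- move=> ac; apply: ad; rewrite -ac.
  move: o; rewrite -ac /normsq /= => o.
  have : (a.1 - b.1) ^+ 2 + (a.2 - b.2) ^+ 2 = 0 by lra.
  move/eqP; rewrite paddr_eq0 ?sqr_ge0 // !expf_eq0 /= => /andP[/eqP e1 /eqP e2].
  by apply: ext_pt => /=; lra.
Qed.

Lemma rectangle_rotate (a b c d : Z2) : rectangle a b c d -> rectangle b c d a.
Proof.
move=> r; have [e o ab cb ac] := rectangle_dot r; case: r => dE _ ad cd.
apply: rectangle_of_dot => //; first by rewrite -e addrC.
- by rewrite -[RHS]oppr0 -o -dE /dot /=; ring.
- by move/esym.
- by move/esym.
Qed.

Section Embedding.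
Variables (n : nat) (g : vertex n -> Z2).
Notation V := (vertex n).
Implicit Types (k : 'I_n) (b : cell n) (v w x y z : V).

Hypothesis g_inj : forall v w, (v.1 <= n)%N -> (w.1 <= n)%N -> g v = g w -> v = w.
Hypothesis g_right : forall x z y, (x.1 <= n)%N -> (z.1 <= n)%N -> (y.1 <= n)%N ->
  x <> z -> y <> z -> x <> y -> dot (g x - g z) (g y - g z) = 0 -> family_triple x z y.
Hypothesis g_fam : forall k b, family_placed g k b.

Lemma g_pair_inj i b j c : (i <= n)%N -> (j <= n)%N -> g (i, b) = g (j, c) ->
  i = j /\ b = c.
Proof. by move=> i_n j_n /g_inj /= /(_ i_n j_n) [-> ->]. Qed.

(** Generations are numbered from 1 here, while vertices are numbered from 0. *)
Definition gen (j : nat) : {fset Z2} := [fset g (j.-1, b) | b in enum (cell n)]%fset.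
Definition all_gens : {fset Z2} := (\bigcup_(j <- iota 1 n.+1) gen j)%fset.

Lemma genP j p : reflect (exists b, p = g (j.-1, b)) (p \in gen j).
Proof.
apply: (iffP (imfsetP _ _ _ _)) => [[b _ ->]|[b ->]]; exists b => //.
by rewrite /= mem_enum.
Qed.

Lemma all_gensP p : reflect (exists2 v, (v.1 <= n)%N & p = g v) (p \in all_gens).
Proof.
apply: (iffP (bigfcupP _ _ _ _)) => [[j /andP[+ _] /genP[b ->]]|[[j b] /= jn ->]].
  by rewrite mem_iota => /andP[j1 jn]; exists (j.-1, b) => //=; lia.
exists j.+1; first by rewrite -[1%N :: _]/(iota 1 n.+1) mem_iota andbT; lia.
by apply/genP; exists b.
Qed.

Lemma gen_sub j : (1 <= j <= n.+1)%N -> {subset gen j <= all_gens}.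
Proof. by move=> jn p /genP[b ->]; apply/all_gensP; exists (j.-1, b) => //=; lia. Qed.

Lemma nuclear_placed k b :
  nuclear_family n.+1 gen (g (parent_of k b)) (g (child_of k b))
    (g (parent_of k (flip k b))) (g (child_of k (flip k b))).
Proof.
have kn := ltn_ord k.
split; last first.
  exists k.+1; split; first by lia.
  - by apply/genP; exists b.
  - by apply/genP; exists (flip k b).
  - by apply/genP; exists b.
  - by apply/genP; exists (flip k b).
have [e o] := g_fam k b; apply: rectangle_of_dot => // /g_inj; rewrite /= => /(_ (ltnW kn) kn) [].
  by move/n_Sn.
by move/n_Sn.
Qed.

Lemma nuclear_swap_children p a q c :
  nuclear_family n.+1 gen p a q c -> nuclear_family n.+1 gen p c q a.
Proof.
case=> r [j [jn pj qj aj cj]]; split; last by exists j.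
have [e o pa qa pq] := rectangle_dot r; case: r => cE _ pc qc.
apply: rectangle_of_dot => //; first by rewrite e [RHS]addrC.
by rewrite -o -cE /dot /=; ring.
Qed.

(** A rectangle is determined by three of its corners, so the fourth corner is
    the remaining member of the family from which the first three come. *)
Lemma triple_nuclear x z y d : family_triple x z y -> g x + g y = g z + d ->
  nuclear_family n.+1 gen (g x) (g z) (g y) d \/
  nuclear_family n.+1 gen (g z) (g y) d (g x).
Proof.
case=> k [b []] [-> -> zE] e; [left|right].
  have [e' _] := g_fam k b.
  by case: zE e => ->; rewrite e' => /esym; first move=> /addrI->;
    last rewrite addrC => /addIr ->; [| apply: nuclear_swap_children]; exact: nuclear_placed.
have [e' _] := g_fam k b; case: zE e => ->; rewrite -e' => /esym.
  move=> /addrI ->; apply: nuclear_swap_children; exact: nuclear_placed.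
rewrite addrC => /addIr ->.
have := nuclear_placed k (flip k b); rewrite flipK; done.
Qed.

Lemma rectangle_nuclear (a b c d : Z2) : rectangle a b c d ->
  a \in all_gens -> b \in all_gens -> c \in all_gens ->
  nuclear_family n.+1 gen a b c d \/ nuclear_family n.+1 gen b c d a.
Proof.
move=> /rectangle_dot [e o ab cb ac] /all_gensP[x xn aE] /all_gensP[z zn bE] /all_gensP[y yn cE].
subst a b c; apply: triple_nuclear e; apply: g_right => //; congruence.
Qed.

(** The right angle of a nuclear family at a child gives a family triple; the
    generations of the corners exclude that the parents occur in it as
    siblings. *)
Lemma nuclearP p a q c : nuclear_family n.+1 gen p a q c -> exists k b,
  [/\ p = g (parent_of k b), q = g (parent_of k (flip k b)) &
      (a = g (child_of k b) /\ c = g (child_of k (flip k b))) \/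
      (a = g (child_of k (flip k b)) /\ c = g (child_of k b))].
Proof.
case=> r [j [jn /genP[bp pE] /genP[bq qE] /genP[ba aE] _]].
have [e o pa qa pq] := rectangle_dot r.
rewrite /= in aE.
have : family_triple (j.-1, bp) (j, ba) (j.-1, bq).
  by apply: g_right; rewrite /= -?pE -?qE -?aE //; [lia|lia|lia| | |]; congruence.
case=> k [b []] [[ej eb] [_ eb'] zE]; last first.
  by case: zE => -[]; lia.
have [e' _] := g_fam k b.
exists k, b; split; first by rewrite pE ej eb.
  by rewrite qE ej eb'.
move: e; rewrite pE qE ej eb eb' => e.
case: zE => zE; [left|right]; split; rewrite ?aE ?zE //.
  apply: (addrI (g (child_of k b))); rewrite -e' -zE -aE e //.
by apply: (addIr (g (child_of k (flip k b)))); rewrite -e' addrC -zE -aE e.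
Qed.

Lemma disjoint_gen : disjoint_generations n.+1 gen.
Proof.
move=> j k p jn kn /genP[b ->] /genP[c /g_inj] /=.
by case/(_ _ _)/Wrap => [||[]]; lia.
Qed.

Lemma closure_gen : closure_property all_gens.
Proof.
have clos (a b c d : Z2) : rectangle a b c d -> a \in all_gens -> b \in all_gens ->
    c \in all_gens -> d \in all_gens.
  move=> r ha hb hc.
  by case: (rectangle_nuclear r ha hb hc) => -[_ [j [jn h1 h2 h3 h4]]];
    [apply: gen_sub h4 | apply: gen_sub h2]; lia.
move=> a b c d r.
have r1 := rectangle_rotate r; have r2 := rectangle_rotate r1; have r3 := rectangle_rotate r2.
have := clos _ _ _ _ r; have := clos _ _ _ _ r1; have := clos _ _ _ _ r2; have := clos _ _ _ _ r3.
rewrite /=; do 4 case: (_ \in all_gens) => //=; move=> h0 h1 h2 h3 _;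
  by [exact: h0 isT isT isT | exact: h1 isT isT isT |
      exact: h2 isT isT isT | exact: h3 isT isT isT].
Qed.

Lemma spouse_and_children_gen : spouse_and_children_property n.+1 gen.
Proof.
move=> j p jn /genP[b ->].
have jn' : (j.-1 < n)%N by lia.
pose k := Ordinal jn'.
exists (g (parent_of k b), g (child_of k b), g (parent_of k (flip k b)), g (child_of k (flip k b))).
split; [exact: nuclear_placed | by left |].
move=> [[[p1 a] q] c] /nuclearP[k' [b' [-> -> ac]]].
have kE b1 b2 : g (j.-1, b1) = g (parent_of k' b2) -> k' = k /\ b1 = b2.
  have := ltn_ord k' => kn' /g_pair_inj [||e ->]; try lia.
  by split=> //; apply: val_inj.
case=> /kE [? ?]; subst; case: ac => -[-> ->]; rewrite /= ?flipK;
  by [constructor 1|constructor 2|constructor 3|constructor 4].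
Qed.

Lemma sibling_and_parents_gen : sibling_and_parents_property n.+1 gen.
Proof.
move=> j p jn /genP[b ->].
have jn' : (j.-1 < n)%N by lia.
pose k := Ordinal jn'.
have jE : j.+1.-1 = k.+1 by rewrite /=; lia.
rewrite jE.
exists (g (parent_of k b), g (child_of k b), g (parent_of k (flip k b)), g (child_of k (flip k b))).
split; [exact: nuclear_placed | by left |].
move=> [[[p1 a] q] c] /nuclearP[k' [b' [-> -> ac]]].
have kE b1 b2 : g (k.+1, b1) = g (child_of k' b2) -> k' = k /\ b1 = b2.
  have := ltn_ord k' => kn' /g_pair_inj [||e ->]; try lia.
  by split=> //; apply: val_inj => /=; lia.
case: ac => -[-> ->] [] /kE [? ?]; subst; rewrite /= ?flipK;
  by [constructor 1|constructor 2|constructor 3|constructor 4].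
Qed.

Lemma nondegeneracy_gen : nondegeneracy_property n.+1 gen.
Proof.
move=> p m q [a [c /nuclearP[k [b [_ _ sib]]]]] [a' [c' /nuclearP[k' [b' [pE -> _]]]]].
have [b0 [pE' ->]] : exists b0, p = g (child_of k b0) /\ m = g (child_of k (flip k b0)).
  by case: sib => -[-> ->]; [exists b | exists (flip k b); rewrite flipK].
have kn := ltn_ord k; have kn' := ltn_ord k'.
move: pE; rewrite pE' => /g_inj /= /(_ kn (ltnW kn')) [ek eb].
move/g_inj => /= /(_ kn (ltnW kn')) [_]; rewrite -eb => /flip_inj2 kk.
by rewrite kk in ek; lia.
Qed.

Lemma faithfulness_gen : faithfulness_property n.+1 gen all_gens.
Proof. by move=> a b c d r ha hb hc _; exact: rectangle_nuclear. Qed.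

Lemma card_all_gens : #|` all_gens|%fset = (n.+1 * 2 ^ n)%N.
Proof.
pose vs := [seq (j, b) | j <- iota 0 n.+1, b <- enum (cell n)].
have vsE v : v \in vs = (v.1 <= n)%N.
  case: v => j b; apply/allpairsP/idP => [[[j' b'] [+ _ [-> _]]]|jn].
    by rewrite mem_iota /=; lia.
  have jI : j \in iota 0 n.+1 by rewrite mem_iota.
  by exists (j, b); split=> //; rewrite mem_enum.
have -> : #|` all_gens|%fset = size (map g vs).
  apply: perm_size; apply: uniq_perm; first exact: fset_uniq.
    rewrite map_inj_in_uniq; first by rewrite allpairs_uniq ?iota_uniq ?enum_uniq // => -[? ?] [].
    by move=> v w; rewrite !vsE; exact: g_inj.
  move=> p; apply/all_gensP/mapP => -[v]; first by rewrite -vsE; exists v.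
  by rewrite vsE; exists v.
by rewrite size_map size_allpairs size_iota -cardE card_ffun card_bool card_ord.
Qed.

Lemma sobolev_sum_gen (R : realType) (s : R) j : (1 <= j <= n.+1)%N ->
  sobolev_sum s (gen j) = \sum_(b : cell n) euclid_norm R (g (j.-1, b)) `^ (2 * s).
Proof.
move=> jn; rewrite /sobolev_sum big_imfset /=; first by rewrite undup_id ?enum_uniq // big_enum.
by move=> b c _ _ /g_pair_inj[] //; lia.
Qed.

End Embedding.

(** * Integrality and growth *)

Lemma common_denominator (rs : seq rat) :
  exists2 D : int, 0 < D & {in rs, forall r, D%:~R * r \is a Num.int}.
Proof.
elim: rs => [|r rs [D D0 hD]]; first by exists 1.
exists (D * denq r); first by rewrite mulr_gt0 ?denq_gt0.
move=> r'; rewrite inE intrM => /orP[/eqP->|/hD h].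
  by rewrite -mulrA (mulrC _ r) -numqE -intrM intr_int.
by rewrite mulrAC rpredM ?intr_int.
Qed.

(** X is M times a common denominator of a rational placement whose generation 0
    lies on the unit circle. A nonzero vector of Z^2 has norm at least 1, so the
    factor M keeps every vertex at distance at least M from 0. *)
Lemma integral_placement n (M : int) : 0 < M -> exists (g : vertex n -> Z2) (X : int),
  [/\ forall v w, (v.1 <= n)%N -> (w.1 <= n)%N -> g v = g w -> v = w,
      forall x z y, (x.1 <= n)%N -> (z.1 <= n)%N -> (y.1 <= n)%N ->
        x <> z -> y <> z -> x <> y -> dot (g x - g z) (g y - g z) = 0 ->
        family_triple x z y,
      forall k b, family_placed g k b &
  [/\ 0 < X, forall b, normsq (g (0%N, b)) = X ^+ 2,
      forall v, (v.1 <= n)%N -> M ^+ 2 <= normsq (g v) &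
      X ^+ 2 * 2 ^+ n <= 4 * normsq (g (n, [ffun=> true]))]].
Proof.
move=> M0; have [f [[S SE [f0 finj fright]] fcirc ffam fcl]] :=
  @placement rat n n (1 / 4) (leqnn n) isT.
have [D D0 hD] := common_denominator ([seq (f v).1 | v <- S] ++ [seq (f v).2 | v <- S]).
pose h v : Z2 := (Num.floor (D%:~R * (f v).1), Num.floor (D%:~R * (f v).2)).
have h1 v : (v.1 <= n)%N -> (h v).1%:~R = D%:~R * (f v).1.
  by rewrite -SE => vS; apply: floorK; apply: hD; rewrite mem_cat (map_f (fun v => (f v).1)).
have h2 v : (v.1 <= n)%N -> (h v).2%:~R = D%:~R * (f v).2.
  by rewrite -SE => vS; apply: floorK; apply: hD; rewrite mem_cat (map_f (fun v => (f v).2)) ?orbT.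
pose g v : Z2 := (M * (h v).1, M * (h v).2).
pose X := M * D; pose l : rat := X%:~R.
have X0 : 0 < X by rewrite mulr_gt0.
have l0 : l != 0 by rewrite intr_eq0 gt_eqF.
have g1 v : (v.1 <= n)%N -> (g v).1%:~R = l * (f v).1.
  by move=> vn; rewrite /g /l /X /= !intrM h1 // mulrA.
have g2 v : (v.1 <= n)%N -> (g v).2%:~R = l * (f v).2.
  by move=> vn; rewrite /g /l /X /= !intrM h2 // mulrA.
have gdot x z y : (x.1 <= n)%N -> (z.1 <= n)%N -> (y.1 <= n)%N ->
    (dot (g x - g z) (g y - g z))%:~R = l ^+ 2 * dot (f x - f z) (f y - f z).
  move=> xn zn yn; rewrite /dot rmorphD !rmorphM !rmorphB /= !g1 // !g2 //.
  by ring.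
have gnorm v : (v.1 <= n)%N -> (normsq (g v))%:~R = l ^+ 2 * dot (f v) (f v).
  move=> vn; rewrite /dot /normsq rmorphD !rmorphXn /= g1 // g2 //.
  by ring.
have inj (a b : int) : a%:~R = b%:~R :> rat -> a = b by apply: intr_inj.
exists g, X; split.
- move=> v w vn wn e; apply: finj; rewrite ?SE //.
  by apply: ext_pt; apply: (mulfI l0); rewrite -?g1 -?g2 // e.
- move=> x z y xn zn yn xz yz xy e; apply: fright; rewrite ?SE //.
  apply: (mulfI (expf_neq0 2 l0)); rewrite mulr0 -gdot // e //.
- move=> k b; have kn := ltn_ord k; have [e o] := ffam k b kn.
  have e1 := congr1 fst e; have e2 := congr1 snd e; rewrite /= in e1 e2.
  split; last by apply: inj; rewrite gdot ?o ?mulr0 //= ltnW.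
  apply: ext_pt; apply: inj; rewrite /= !intrD.
    by rewrite !g1 /= ?(ltnW kn) // -!mulrDr e1.
  by rewrite !g2 /= ?(ltnW kn) // -!mulrDr e2.
split=> //.
- by move=> b; apply: inj; rewrite gnorm // fcirc mulr1 rmorphXn.
- move=> v vn; have hv : h v <> 0.
    move=> e; have := f0 v; rewrite SE vn => /(_ isT) /eqP; apply.
    have D0' : D%:~R != 0 :> rat by rewrite intr_eq0 gt_eqF.
    by apply: ext_pt; apply: (mulfI D0'); rewrite -?h1 -?h2 // e mulr0.
  have -> : normsq (g v) = M ^+ 2 * normsq (h v) by rewrite /normsq /g /=; ring.
  rewrite -[leLHS]mulr1 ler_wpM2l ?sqr_ge0 // -gtz0_ge1 lt_def addr_ge0 ?sqr_ge0 // andbT.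
  apply/eqP => e; apply: hv; apply: dot_eq0; exact: e.
- rewrite -(ler_int rat) [leLHS]intrM [leRHS]intrM gnorm // !rmorphXn /= -/l.
  have l20 : 0 <= l ^+ 2 by exact: sqr_ge0.
  suff : 2 ^+ n <= 4 * dot (f (n, [ffun=> true])) (f (n, [ffun=> true])).
    by rewrite mulrCA; exact: ler_wpM2l.
  have := fcl [ffun=> true] (fun i _ => ffunE _ i).
  have := ideal_norm rat n ([ffun=> true] : cell n); have := @exprn_ege1 rat n 2 isT.
  move: (f _) (ideal _ _ _) => [a b] [u v]; rewrite /close_pt /dot /=.
  move: (2 ^+ n) => E E1 EE [a1 a2 b1 b2].
  (* The target has norm at least 1, so an error of 1/4 in each coordinate costs
     less than half of it. *)
  have ha : (a - u) ^+ 2 <= 1 / 16 by nra.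
  have hb : (b - v) ^+ 2 <= 1 / 16 by nra.
  have := sqr_ge0 (2 * a - u); have := sqr_ge0 (2 * b - v).
  have := sqr_ge0 a; have := sqr_ge0 b.
  by move: ha hb EE; rewrite !expr2; lra.
Qed.

Section Growth.
Variable R : realType.

Lemma euclid_norm_powR (s : R) (p : Z2) :
  euclid_norm R p `^ (2 * s) = (normsq p)%:~R `^ s.
Proof.
have p0 : 0 <= (normsq p)%:~R :> R by rewrite ler0z addr_ge0 ?sqr_ge0.
by rewrite powRrM powR_mulrn ?sqrtr_ge0 // /euclid_norm sqr_sqrtr.
Qed.

Lemma exprn_unbounded (a Q : R) (N0 : nat) : 1 < a ->
  exists2 n, (N0 <= n)%N & Q <= a ^+ n.
Proof.
move=> a1; have a10 : 0 < a - 1 by lra.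
have bern m : 1 + (a - 1) *+ m <= a ^+ m.
  elim: m => [|m IH]; first by rewrite mulr0n addr0 expr0.
  have : 0 <= (a - 1) *+ m by rewrite mulrn_wge0 // ltW.
  rewrite exprS mulrSr => h; have : a * (1 + (a - 1) *+ m) <= a * a ^+ m.
    by rewrite ler_wpM2l //; lra.
  nra.
pose m := Num.bound `|Q / (a - 1)|.
exists (N0 + m)%N; first exact: leq_addr.
apply: le_trans (bern _); rewrite mulrnDr.
have : 0 <= (a - 1) *+ N0 by rewrite mulrn_wge0 // ltW.
have : Q <= (a - 1) *+ m.
  rewrite -mulr_natr mulrC -ler_pdivrMr //; apply: le_trans (ler_norm _) _.
  by apply: ltW; apply: archi_boundP.
lra.
Qed.
End Growth.

Theorem proposition2p1 (R : realType) (s : R) (hs : 1 < s) :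
  exists2 c : R, 0 < c &
  forall N0 : nat,
  exists delta0 K0 : R, 0 < delta0 /\
  forall delta K : R, 0 < delta -> delta < delta0 -> K0 < K ->
  exists2 N : nat, (N0 < N)%N &
  exists C : R, forall Rad : R, C < Rad ->
  exists (Lam : {fset Z2}) (L : nat -> {fset Z2}),
    (Lam = \bigcup_(j <- iota 1 N) L j)%fset /\
    disjoint_generations N L /\
    closure_property Lam /\
    spouse_and_children_property N L /\
    sibling_and_parents_property N L /\
    nondegeneracy_property N L /\
    faithfulness_property N L Lam /\
    c * (K ^+ 2 / delta ^+ 2) <= sobolev_sum s (L N) / sobolev_sum s (L 1%N) /\
    #|` Lam|%fset = (N * 2 ^ N.-1)%N /\
    (forall n : Z2, n \in Lam -> Rad <= euclid_norm R n).
Proof.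
exists (4 `^ (- s)); first by rewrite powR_gt0.
move=> N0; exists 1, 0; split=> // delta K delta0 _ _.
have a1 : 1 < 2 `^ (s - 1) :> R.
  rewrite -[ltLHS](congr1 (fun h => h (s - 1)) (powR1 R)).
  by rewrite gt0_ltr_powR ?nnegrE ?ler01 ?ler0n ?ltr1n //; lra.
have [n N0n growth] := exprn_unbounded (K ^+ 2 / delta ^+ 2) N0 a1.
exists n.+1 => //; exists 0 => Rad Rad0.
pose M : int := (Num.bound Rad)%:Z + 1.
have M0 : 0 < M by rewrite /M; lia.
have [g [X [ginj gright gfam [X0 gX gM gtop]]]] := integral_placement n M0.
exists (all_gens g), (gen g); split=> //.
split; first exact: disjoint_gen.
split; first exact: closure_gen.
split; first exact: spouse_and_children_gen.
split; first exact: sibling_and_parents_gen.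
split; first exact: nondegeneracy_gen.
split; first exact: faithfulness_gen.
split; last split; last first.
- move=> p /all_gensP[v vn ->]; rewrite /euclid_norm.
  have -> : Rad = Num.sqrt (Rad ^+ 2) by rewrite sqrtr_sqr gtr0_norm.
  rewrite ler_sqrt ?ler0z ?addr_ge0 ?sqr_ge0 //.
  have := gM v vn; rewrite -(ler_int R); apply: le_trans.
  rewrite rmorphXn /= lerXn2r ?nnegrE ?ltW ?ler0z ?ltr0z //.
  rewrite /M intrD; have := archi_boundP (ltW Rad0); rewrite -pmulrn; lra.
- exact: card_all_gens.
rewrite !sobolev_sum_gen //=.
set X2 : R := (X ^+ 2)%:~R.
have X20 : 0 < X2 by rewrite ltr0z exprn_gt0.
have -> : \sum_(b : cell n) euclid_norm R (g (0%N, b)) `^ (2 * s) = 2 ^+ n * X2 `^ s.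
  rewrite (eq_bigr (fun=> X2 `^ s)); last by move=> b _; rewrite euclid_norm_powR gX.
  by rewrite sumr_const card_ffun card_bool card_ord -[LHS]mulr_natl natrX.
have top : 4 `^ (- s) * (2 ^+ n) `^ s * X2 `^ s <=
    \sum_(b : cell n) euclid_norm R (g (n, b)) `^ (2 * s).
  rewrite (bigD1 [ffun=> true]) //= euclid_norm_powR ler_wpDr //.
    by apply: sumr_ge0 => b _; exact: powR_ge0.
  have N0' : 0 <= (normsq (g (n, [ffun=> true])))%:~R :> R.
    by rewrite ler0z addr_ge0 ?sqr_ge0.
  rewrite -mulrA powRN mulrC ler_pdivrMr ?powR_gt0 //.
  rewrite -!powRM ?exprn_ge0 ?(ltW X20) //.
  rewrite ge0_ler_powR ?nnegrE ?mulr_ge0 ?exprn_ge0 ?(ltW X20) //; first by lra.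
  move: gtop; rewrite -(ler_int R) [leLHS]intrM [leRHS]intrM mulrC [leRHS]mulrC.
  by rewrite rmorphXn.
rewrite ler_pdivlMr ?mulr_gt0 ?exprn_gt0 ?powR_gt0 //; apply: le_trans top.
rewrite [leLHS]mulrA ler_wpM2r ?powR_ge0 // -mulrA ler_wpM2l ?powR_ge0 //.
have -> : (2 ^+ n) `^ s = (2 `^ (s - 1)) ^+ n * 2 ^+ n :> R.
  rewrite -exprMn -powR_mulrn ?powR_ge0 // -powR_mulrn ?mulr_ge0 ?powR_ge0 //.
  rewrite -powRrM mulrC powRrM; congr (_ `^ _).
  by rewrite mulrC mulr_powRB1 //; lra.
by rewrite ler_wpM2r ?exprn_ge0.
Qed.
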